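(* Let $c_1,\ldots,c_m$ be (not necessarily distinct) non-negative integers, and let $1\le n<m$. Take a simple random sample of size $n$ without replacement from $c_1,\ldots,c_m$, let $Y_1,\ldots,Y_n$ denote the sampled values, and let $W=Y_1+\cdots+Y_n$. Let $$\theta=\mathbb{E}W=\frac{n}{m}\sum_{j=1}^mc_j,\qquad \sigma^2=\mathrm{Var}(W)=\frac{n}{m}\sum_{j=1}^mc_j^2+\frac{n(n-1)}{m(m-1)}\sum_{i=1}^m\sum_{j\not=i}c_ic_j-\frac{n^2}{m^2}\left(\sum_{j=1}^mc_j\right)^2,$$ with $\sigma^2>0$. Then $$d_{\mathrm W}(\widetilde{W},\widetilde{Z})\leq\frac{\sum_{j=1}^mc_j^3}{\sigma\sum_{j=1}^mc_j^2}+\sqrt{\frac{8}{\pi}}\,\frac{n}{m}\,\sigma^{-2}\left(\frac{n}{m}\left(\sum_{j=1}^mc_j\right)^2-\frac{n-1}{m-1}\sum_{i=1}^m\sum_{j\not=i}c_ic_j\right),$$ where $\widetilde{W}=\sigma^{-1}(W-\theta)$ and $\widetilde{Z}\sim\mathrm{N}(0,1)$.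
   Context: Sampling without replacement: the indices of the sampled elements form a uniformly random ordered $n$-tuple of distinct elements of $\{1,\ldots,m\}$, and $Y_k$ is the value $c_J$ at the $k$th sampled index $J$. Wasserstein distance: $d_{\mathrm W}(X,X')=\sup\{|\mathbb{E}h(X)-\mathbb{E}h(X')|: |h(x)-h(y)|\le|x-y| \text{ for all } x,y\in\mathbb{R}\}$. *)

(* Defs.v *)
From HB Require Import structures.
From mathcomp Require Import all_boot all_order all_algebra.
From mathcomp Require Import all_classical all_reals all_analysis.
Set Implicit Arguments.
Unset Strict Implicit.
Unset Printing Implicit Defensive.
Import Order.TTheory GRing.Theory Num.Theory.
Import numFieldNormedType.Exports.
Local Open Scope classical_set_scope.
Local Open Scope ring_scope.

(* The events [J = t] are required to be measurable because the finite type of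
   tuples of indices carries no canonical sigma-algebra; here it is discrete. *)
Definition simple_random_sample d (T : measurableType d) (R : realType)
    (P : probability T R) (m n : nat) (J : T -> n.-tuple 'I_m) : Prop :=
  forall t : n.-tuple 'I_m,
    measurable (J @^-1` [set t]) /\
    P (J @^-1` [set t]) =
      (if uniq t then #|[set s : n.-tuple 'I_m | uniq s]%SET|%:R^-1 else 0)%:E.

(* X and X' may live on different probability spaces.  The difference of
   expectations is taken in \bar R; it is the usual one as soon as X and X' are
   integrable, since then so are h \o X and h \o X' for every Lipschitz h. *)
Definition wasserstein d (T : measurableType d) d' (T' : measurableType d')
    (R : realType) (P : probability T R) (P' : probability T' R)
    (X : T -> R) (X' : T' -> R) : \bar R :=
  ereal_sup [set `| 'E_P[h \o X] - 'E_P'[h \o X'] |%E |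
              h in [set h : R -> R | forall x y, `|h x - h y| <= `|x - y|]].

(* Equality is required on measurable sets only: the underlying set functions
   are total and need not agree elsewhere. *)
Definition standard_normal d (T : measurableType d) (R : realType)
    (P : probability T R) (Z : {RV P >-> R}) : Prop :=
  forall A : set R, measurable A -> distribution P Z A = normal_prob 0 1 A.

(* Main.v *)
Require Import Defs.
From HB Require Import structures.
From mathcomp Require Import all_boot all_order all_algebra.
From mathcomp Require Import all_classical all_reals all_analysis.
From mathcomp Require Import measurable_realfun ring lra.
Set Implicit Arguments.
Unset Strict Implicit.
Unset Printing Implicit Defensive.
Import Order.TTheory GRing.Theory Num.Theory.
Import numFieldNormedType.Exports.
Local Open Scope classical_set_scope.
Local Open Scope ring_scope.

(** Write [w] for the sample sum, [theta] and [V] for its mean and variance,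
    [S2] and [S3] for the sums of the squares and cubes of the weights [a j],
    and [lam = n / m * S2].

    Size bias.  Exchanging a drawn index with an undrawn one is an involution on
    the triples (sample, position, index outside the sample).  It gives
    [m * E[w f(w)] = \sum_j a j \sum_k E[f(w + a j - delta)]], where [j] is forced
    into the sample at the expense of the value [delta >= 0] displaced from it
    ([size_bias]).  With [f] the identity this says that the total displacement,
    weighted by the [a j], is [m * (lam - V)] ([total_displacement]); in
    particular [V <= lam].

    Stein's method.  If [w] had been increased by [a j] without anything being
    displaced, a Taylor expansion of [f] would make [w] look like a normal
    variable of variance [lam], not [V].  So [(w - theta) / sqrt lam] is compared
    with the standard normal law: for the solution [g] of
    [g' x - x g x = h x - E h(Z)], the displacement costs [(lam - V) / lam], as
    [g] is 1-Lipschitz, and the Taylor remainder costs [S3 / (sqrt lam * S2)], as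
    [g'] is 2-Lipschitz ([stein_sample_bound]).  Rescaling by
    [r = sqrt lam / sqrt V >= 1] turns the second cost into the first term of the
    announced bound exactly, which a normalisation by [sqrt V] from the start
    would not.  It also turns the standard normal law into that of [r Z], whose
    distance to [Z] is at most [(r - 1) E|Z|] ([gauss_mean_dilation]).  Both
    errors proportional to [lam - V] then fit in the second term because
    [E|Z| = sqrt (2 / pi) >= 2 / 3] ([dilation_tradeoff]).

    Regularity of the Stein solution ([stein_solution]).  With [p] the normal
    density, [Phi] its distribution function and [Phic = 1 - Phi], both [p g']
    and [p] times the derivative of [x g x] are combinations, with coefficients
    of known sign, of the truncated moments [l] and [u] of [h - h x] to the left
    and to the right of [x]; and [|l| <= p x + x Phi x], [|u| <= p x - x Phic x]
    for 1-Lipschitz [h].  What remains are inequalities between [Phi], [Phic] and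
    [p], which follow from rational lower bounds on Mills' ratio
    ([mills_quotient]).  They make [g] and [x g x] 1-Lipschitz, and [g'] is the
    sum of [x g x], of [h] and of a constant. *)

(** * Exchanging a sampled index with an unsampled one *)

Section Swap.
Context {V : nmodType} {I : finType} {n : nat}.
Implicit Types (t : n.-tuple I) (k : 'I_n) (j : I).

Definition swap t k j : n.-tuple I :=
  [tuple if i == k then j else tnth t i | i < n].

Lemma tnth_swap t k j i : tnth (swap t k j) i = if i == k then j else tnth t i.
Proof. by rewrite tnth_mktuple. Qed.

Lemma swapK t k j : swap (swap t k j) k (tnth t k) = t.
Proof.
by apply: eq_from_tnth => i; rewrite !tnth_swap; case: eqVneq => [->|].
Qed.

Lemma uniq_swap t k j : uniq t && (j \notin t) ->
  uniq (swap t k j) && (tnth t k \notin swap t k j).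
Proof.
move=> /andP[/tuple_uniqP t_inj jt]; apply/andP; split.
  apply/tuple_uniqP => i1 i2; rewrite !tnth_swap.
  case: eqVneq => [->|i1k]; case: eqVneq => [->|i2k] //.
  - by move=> jE; rewrite jE mem_tnth in jt.
  - by move=> jE; rewrite -jE mem_tnth in jt.
  - exact: t_inj.
apply/negP => /tnthP[i]; rewrite tnth_swap; case: eqVneq => [_ tkj|ik /t_inj kE].
  by rewrite -tkj mem_tnth in jt.
by rewrite kE eqxx in ik.
Qed.

(** The map [(t, k, j) |-> (swap t k j, k, tnth t k)] is an involution of the
    triples summed over. *)
Lemma sum_swap (F : n.-tuple I -> 'I_n -> I -> V) :
  \sum_(t : n.-tuple _ | uniq t) \sum_k \sum_(j | j \notin t) F t k j =
  \sum_(t : n.-tuple _ | uniq t) \sum_k \sum_(j | j \notin t)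
    F (swap t k j) k (tnth t k).
Proof.
rewrite [LHS]pair_big_dep [RHS]pair_big_dep [LHS]pair_big_dep [RHS]pair_big_dep/=.
rewrite (reindex_inj (h := fun u => ((swap u.1.1 u.1.2 u.2, u.1.2), tnth u.1.1 u.1.2)))/=.
  apply: eq_bigl => -[[t k] j]/=; rewrite !andbT.
  apply/idP/idP => [/(uniq_swap k)|/(uniq_swap k) //].
  by rewrite swapK tnth_swap eqxx.
apply: (can_inj (g := fun u => ((swap u.1.1 u.1.2 u.2, u.1.2), tnth u.1.1 u.1.2))).
by move=> [[t k] j]/=; rewrite swapK tnth_swap eqxx.
Qed.

End Swap.

(** * Averages over ordered samples, and the size-bias identity *)

Section Average.
Context {R : realType} {m n : nat}.
Implicit Types (F G : n.-tuple 'I_m -> R) (a : 'I_m -> R) (t : n.-tuple 'I_m).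

Definition avg F : R :=
  #|[set t : n.-tuple 'I_m | uniq t]%SET|%:R^-1 * \sum_(t : n.-tuple _ | uniq t) F t.

Definition sample_sum a (t : n.-tuple 'I_m) : R := \sum_(k < n) a (tnth t k).

Lemma avgD F G : avg (fun t => F t + G t) = avg F + avg G.
Proof. by rewrite /avg big_split mulrDr. Qed.

Lemma avgZ r F : avg (fun t => r * F t) = r * avg F.
Proof. rewrite /avg -mulr_sumr. by rewrite mulrCA. Qed.

Lemma avgB F G : avg (fun t => F t - G t) = avg F - avg G.
Proof. by rewrite /avg sumrB mulrBr. Qed.

Lemma avg_sum (I : Type) (r : seq I) (P : pred I) (F : I -> n.-tuple 'I_m -> R) :
  avg (fun t => \sum_(i <- r | P i) F i t) = \sum_(i <- r | P i) avg (F i).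
Proof. by rewrite /avg exchange_big mulr_sumr. Qed.

Lemma eq_avg F G : (forall t, uniq t -> F t = G t) -> avg F = avg G.
Proof. by move=> FG; rewrite /avg (eq_bigr G). Qed.

Lemma le_avg F G : (forall t, uniq t -> F t <= G t) -> avg F <= avg G.
Proof. by move=> FG; rewrite ler_wpM2l// ?invr_ge0// ler_sum. Qed.

Lemma ler_norm_avg F : `|avg F| <= avg (fun t => `|F t|).
Proof.
rewrite /avg normrM ger0_norm ?invr_ge0//.
by rewrite ler_wpM2l ?invr_ge0// ler_norm_sum.
Qed.

Lemma avg_cst : (n <= m)%N -> forall r, avg (fun=> r) = r.
Proof.
move=> nm r; rewrite /avg sumr_const.
rewrite -[in X in r *+ X]cardsE -[r *+ _]mulr_natr mulrCA mulVf ?mulr1//.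
rewrite pnatr_eq0 -lt0n; apply/card_gt0P.
exists [tuple widen_ord nm i | i < n]; rewrite inE.
apply/tuple_uniqP => i j; rewrite !tnth_mktuple => /(congr1 val) ij.
exact: val_inj.
Qed.

Lemma sample_sum_swap a t k j :
  sample_sum a (swap t k j) = sample_sum a t - a (tnth t k) + a j.
Proof.
rewrite /sample_sum (bigD1 k)//= [in RHS](bigD1 k)//= tnth_swap eqxx.
rewrite (eq_bigr (fun i => a (tnth t i))); last first.
  by move=> i /negPf ik; rewrite tnth_swap ik.
ring.
Qed.

Lemma sum_mem_sample a t : uniq t ->
  \sum_(j | j \in t) a j = sample_sum a t.
Proof. by move=> ut; rewrite -big_uniq//= big_tuple. Qed.

Lemma sum_notin_sample a t : uniq t ->
  \sum_(j | j \notin t) a j = \sum_j a j - sample_sum a t.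
Proof.
by move=> ut; rewrite -(sum_mem_sample a ut) [X in _ = X - _](bigID (mem t))/= [RHS]addrC addKr.
Qed.

(** The value that leaves the sample at position [k] when index [j] is forced
    into it.  If [j] is already drawn, adding [a j] and removing it again leaves
    the sample sum unchanged. *)
Definition displaced a t k j : R := if j \in t then a j else a (tnth t k).

(** Summed over [j], the samples that contain [j] contribute [n * E[w f(w)]].  In
    the other terms,
    [sum_swap] exchanges the roles of the incoming index [j] and of the outgoing
    one, which leaves [a (tnth t k) * f w]; each sample occurs there once for
    each of its [m - n] absent indices. *)
Lemma size_bias a (f : R -> R) :
  m%:R * avg (fun t => sample_sum a t * f (sample_sum a t)) =
  \sum_j a j * \sum_k avg (fun t => f (sample_sum a t + a j - displaced a t k j)).
Proof.
set w := sample_sum a.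
have -> : \sum_j a j * \sum_k avg (fun t => f (w t + a j - displaced a t k j)) =
    avg (fun t => n%:R * (w t * f (w t))) +
    avg (fun t => \sum_k \sum_(j | j \notin t) a j * f (w t - a (tnth t k) + a j)).
  rewrite -avgD.
  under eq_bigr do rewrite -avg_sum -avgZ.
  rewrite -avg_sum; apply: eq_avg => t ut.
  rewrite (bigID (mem t))/= [X in _ + X = _](eq_bigr (fun j =>
     \sum_k a j * f (w t - a (tnth t k) + a j))); last first.
    move=> j /negPf jt; rewrite mulr_sumr; apply: eq_bigr => k _.
    by rewrite /displaced jt addrAC.
  rewrite [X in _ + X = _]exchange_big; congr (_ + _).
  rewrite (eq_bigr (fun j => n%:R * (f (w t)) * a j)); last first.
    move=> j jt; rewrite (eq_bigr (fun=> f (w t))).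
      by rewrite sumr_const card_ord -[_ *+ _]mulr_natr; ring.
    by move=> k _; rewrite /displaced jt addrK.
  by rewrite -mulr_sumr (sum_mem_sample a ut) -/w; ring.
have -> : avg (fun t => \sum_k \sum_(j | j \notin t) a j * f (w t - a (tnth t k) + a j))
  = avg (fun t => (m%:R - n%:R) * (w t * f (w t))).
  rewrite /avg sum_swap; congr (_ * _); apply: eq_bigr => t ut.
  rewrite (eq_bigr (fun k => (m%:R - n%:R) * f (w t) * a (tnth t k))).
    by rewrite -mulr_sumr -/(sample_sum a t) -/w; ring.
  move=> k _; rewrite (eq_bigr (fun=> a (tnth t k) * f (w t))); last first.
    by move=> j jt; rewrite tnth_swap eqxx /w sample_sum_swap addrK subrK.
  have := @sum_notin_sample (fun=> a (tnth t k) * f (w t)) t ut.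
  move=> ->; rewrite /sample_sum !sumr_const !card_ord.
  by rewrite -[X in X - _ = _]mulr_natl -[X in _ - X = _]mulr_natl; ring.
rewrite -avgD -avgZ; apply: eq_avg => t _; ring.
Qed.

Lemma avg_sample_sum a : (n < m)%N ->
  avg (sample_sum a) = n%:R / m%:R * \sum_j a j.
Proof.
move=> nm; have m0 : m%:R != 0 :> R by rewrite pnatr_eq0 -lt0n (leq_ltn_trans _ nm).
apply: (mulfI m0).
have := size_bias a (fun=> 1).
under eq_avg do rewrite mulr1.
move=> ->; rewrite avg_cst; last exact: ltnW.
rewrite sumr_const card_ord -mulr_suml; field; exact: m0.
Qed.

Lemma avg_sample_sum_displaced a : (n < m)%N ->
  \sum_j a j * \sum_k avg (fun t => displaced a t k j) =
  n%:R ^+ 2 / m%:R * \sum_j a j ^+ 2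
  + (\sum_j a j) * avg (sample_sum a) - avg (fun t => sample_sum a t ^+ 2).
Proof.
move=> nm; set w := sample_sum a.
have -> : n%:R ^+ 2 / m%:R * \sum_j a j ^+ 2 = n%:R * avg (sample_sum (fun j => a j ^+ 2)).
  by rewrite avg_sample_sum//; ring.
rewrite -!avgZ -avgD -avgB.
under eq_bigr do rewrite -avg_sum -avgZ.
rewrite -avg_sum; apply: eq_avg => t ut.
rewrite (bigID (mem t))/=.
rewrite (eq_bigr (fun j => n%:R * a j ^+ 2)); last first.
  move=> j jt; rewrite (eq_bigr (fun=> a j)) ?sumr_const ?card_ord.
    by rewrite -[_ *+ _]mulr_natl; ring.
  by move=> k _; rewrite /displaced jt.
rewrite [X in _ + X](eq_bigr (fun j => w t * a j)); last first.
  move=> j /negPf jt; rewrite mulrC; congr (_ * _).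
  by apply: eq_bigr => k _; rewrite /displaced jt.
rewrite -!mulr_sumr (sum_mem_sample _ ut) (sum_notin_sample _ ut) -/w; ring.
Qed.

(** Together with [avg_sample_sum_displaced] this determines the second moment of
    the sample sum. *)
Lemma size_bias_square a : (n < m)%N ->
  m%:R * avg (fun t => sample_sum a t ^+ 2) =
  n%:R * (\sum_j a j) * avg (sample_sum a) + n%:R * \sum_j a j ^+ 2
  - \sum_j a j * \sum_k avg (fun t => displaced a t k j).
Proof.
move=> nm; rewrite (size_bias a (fun x => x)).
rewrite (eq_bigr (fun j => n%:R * avg (sample_sum a) * a j + n%:R * a j ^+ 2 -
   a j * \sum_k avg (fun t => displaced a t k j))).
  rewrite sumrB big_split/= -!mulr_sumr; ring.
move=> j _.
rewrite (eq_bigr (fun k => (avg (sample_sum a) + a j) - avg (fun t => displaced a t k j))).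
  by rewrite sumrB sumr_const card_ord -[_ *+ n]mulr_natl; ring.
by move=> k _; rewrite avgB avgD avg_cst// ltnW.
Qed.

(** By [size_bias] for the identity, the displacement is exactly what separates the
    variance of the sample sum from [n / m] times the sum of squares.  For
    non-negative [a] it is non-negative, whence an upper bound on the variance. *)
Lemma total_displacement a : (n < m)%N ->
  \sum_j a j * \sum_(k < n) avg (fun t => displaced a t k j) =
  m%:R * (n%:R / m%:R * \sum_j a j ^+ 2
          - (avg (fun t => sample_sum a t ^+ 2) - avg (sample_sum a) ^+ 2)).
Proof.
move=> nm; have m0 : m%:R != 0 :> R by rewrite pnatr_eq0 -lt0n (leq_ltn_trans _ nm).
have E := size_bias_square a nm.
have thetaE : n%:R * (\sum_j a j) = m%:R * avg (sample_sum a).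
  by rewrite avg_sample_sum//; field.
rewrite thetaE in E.
transitivity (m%:R * avg (sample_sum a) * avg (sample_sum a)
    + n%:R * (\sum_j a j ^+ 2) - m%:R * avg (fun t => sample_sum a t ^+ 2)).
  by rewrite E; ring.
by field.
Qed.

Lemma sum_offdiag a :
  \sum_(i < m) \sum_(j < m | j != i) a i * a j = (\sum_j a j) ^+ 2 - \sum_j a j ^+ 2.
Proof.
apply/eqP; rewrite eq_sym subr_eq addrC -big_split/= expr2 mulr_suml; apply/eqP.
by apply: eq_bigr => i _; rewrite -mulr_sumr [in LHS](bigD1 i)//= mulrDr expr2.
Qed.

Lemma avg_sample_sum_square a : (0 < n)%N -> (n < m)%N ->
  avg (fun t => sample_sum a t ^+ 2) = n%:R / m%:R * \sum_j a j ^+ 2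
    + (n%:R * (n%:R - 1)) / (m%:R * (m%:R - 1)) *
      \sum_(i < m) \sum_(j < m | j != i) a i * a j.
Proof.
move=> n0 nm; have m0 : m%:R != 0 :> R by rewrite pnatr_eq0 -lt0n (leq_ltn_trans _ nm).
have m1 : m%:R - 1 != 0 :> R.
  by rewrite subr_eq0 pnatr_eq1 gtn_eqF// (leq_ltn_trans _ nm).
rewrite sum_offdiag; apply: (mulfI m1).
have := size_bias_square a nm; rewrite (avg_sample_sum_displaced a nm) avg_sample_sum//.
set w2 := avg _ => E.
have -> : (m%:R - 1) * w2 = m%:R * w2 - w2 by ring.
by rewrite E; field; rewrite m0 m1.
Qed.

End Average.

(** * The Stein bound for a sample sum *)

Section SteinSample.
Context {R : realType} {m n : nat}.
Implicit Types (a : 'I_m -> R) (g dg : R -> R).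

Lemma displaced_ge0 a (t : n.-tuple 'I_m) k j :
  (forall i, 0 <= a i) -> 0 <= displaced a t k j.
Proof. by move=> a0; rewrite /displaced; case: ifP. Qed.

(** By [size_bias], the averaged quantity is a sum of the differences
    [f (w + a j - delta) - f w - a j / s * g'], where [f x = g ((x - theta) / s)].
    After division by [m * s], the choice of [s] makes the coefficients of [g']
    add up to one.  Each
    difference is a Taylor remainder plus the effect of [delta]. *)
Lemma stein_sample_bound a g dg (s : R) (w := @sample_sum R m n a)
    (theta := avg w) (z := fun t => (w t - theta) / s) : (n < m)%N -> (forall j, 0 <= a j) ->
  0 < s -> s ^+ 2 = n%:R / m%:R * \sum_j a j ^+ 2 ->
  (forall x y, `|g x - g y| <= `|x - y|) ->
  (forall x b, 0 <= b -> `|g (x + b) - g x - b * dg x| <= b ^+ 2) ->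
  `|avg (fun t => dg (z t) - z t * g (z t))| <=
  (s ^+ 2 - (avg (fun t => w t ^+ 2) - theta ^+ 2)) / s ^+ 2
  + (\sum_j a j ^+ 3) / (s * \sum_j a j ^+ 2).
Proof.
move=> nm a0 s0 sE glip gtaylor.
have m0 : 0 < m%:R :> R by rewrite ltr0n (leq_ltn_trans _ nm).
have s_neq0 : s != 0 by rewrite gt_eqF.
have m_neq0 : m%:R != 0 :> R by rewrite gt_eqF.
set S2 := \sum_j a j ^+ 2 in sE *; set S3 := \sum_j a j ^+ 3.
have S2_neq0 : S2 != 0.
  by apply/eqP => S20; move: (exprn_gt0 2 s0); rewrite sE S20 mulr0 ltxx.
have thetaE : m%:R * theta = n%:R * \sum_j a j.
  by rewrite /theta /w avg_sample_sum//; field.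
pose delta := \sum_j a j * \sum_(k < n) avg (fun t => displaced a t k j).
have deltaE : delta = m%:R * (s ^+ 2 - (avg (fun t => w t ^+ 2) - theta ^+ 2)).
  by rewrite /delta total_displacement// sE.
pose f x := g ((x - theta) / s).
have main : m%:R * s * avg (fun t => dg (z t) - z t * g (z t)) =
    - \sum_j \sum_(k < n) a j * avg (fun t => f (w t + a j - displaced a t k j) - f (w t)
                               - a j / s * dg (z t)).
  have -> : m%:R * s * avg (fun t => dg (z t) - z t * g (z t)) =
      m%:R * s * avg (fun t => dg (z t)) - m%:R * avg (fun t => w t * f (w t))
      + m%:R * theta * avg (fun t => f (w t)).
    rewrite -2!(avgZ (m%:R * s)) -(avgZ m%:R (fun t => w t * _)).
    rewrite -(avgZ (m%:R * theta)) -avgB -avgD.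
    by apply: eq_avg => t ut; rewrite /f /z; field.
  have msE : m%:R * s = n%:R / s * S2.
    apply: (mulIf s_neq0); transitivity (m%:R * s ^+ 2); first by ring.
    by rewrite sE; field; rewrite s_neq0.
  have -> : \sum_j \sum_(k < n) a j *
      avg (fun t => f (w t + a j - displaced a t k j) - f (w t) - a j / s * dg (z t)) =
    \sum_j a j * (\sum_(k < n) avg (fun t => f (w t + a j - displaced a t k j)))
    - (n%:R * \sum_j a j) * avg (fun t => f (w t))
    - n%:R / s * S2 * avg (fun t => dg (z t)).
    rewrite /S2 !mulr_sumr !mulr_suml -!sumrB; apply: eq_bigr => j _.
    rewrite -mulr_sumr.
    rewrite (eq_bigr (fun k => avg (fun t => f (w t + a j - displaced a t k j))
      - avg (fun t => f (w t)) - a j / s * avg (fun t => dg (z t)))); last first.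
      by move=> k _; rewrite !avgB avgZ.
    rewrite !sumrB !sumr_const card_ord.
    rewrite -[X in _ - X - _]mulr_natl -[X in _ - _ - X]mulr_natl.
    by field.
  by rewrite size_bias -/w thetaE msE; ring.
have step j k : `|avg (fun t => f (w t + a j - displaced a t k j) - f (w t)
       - a j / s * dg (z t))| <= (a j / s) ^+ 2 + avg (fun t => displaced a t k j) / s.
  apply: (le_trans (ler_norm_avg _)).
  rewrite -[X in X + _](avg_cst (m := m) (n := n) (ltnW nm)) [X in _ + X]mulrC.
  rewrite -avgZ -avgD; apply: le_avg => t ut.
  have -> : f (w t + a j - displaced a t k j) - f (w t) - a j / s * dg (z t) =
     (g (z t + a j / s) - g (z t) - a j / s * dg (z t)) +
     (f (w t + a j - displaced a t k j) - g (z t + a j / s)).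
    by rewrite /f /z; ring.
  apply: (le_trans (ler_normD _ _)); apply: lerD.
    by apply: gtaylor; rewrite divr_ge0// ltW.
  apply: (le_trans (glip _ _)).
  have -> : (w t + a j - displaced a t k j - theta) / s - (z t + a j / s) =
     - (s^-1 * displaced a t k j) by rewrite /z; field.
  rewrite normrN ger0_norm// mulr_ge0 ?invr_ge0 ?(ltW s0)//.
  exact: displaced_ge0.
have ms0 : 0 < m%:R * s by rewrite mulr_gt0.
rewrite -(ler_pM2l ms0) -{1}[m%:R * s](gtr0_norm ms0) -normrM main normrN.
apply: (le_trans (ler_norm_sum _ _ _)).
apply: (@le_trans _ _ (\sum_j \sum_(k < n) a j *
   ((a j / s) ^+ 2 + avg (fun t => displaced a t k j) / s))).
  apply: ler_sum => j _; apply: (le_trans (ler_norm_sum _ _ _)).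
  by apply: ler_sum => k _; rewrite normrM ger0_norm// ler_wpM2l.
have -> : \sum_j \sum_(k < n) a j * ((a j / s) ^+ 2 + avg (fun t => displaced a t k j) / s)
    = n%:R / s ^+ 2 * S3 + delta / s.
  rewrite mulr_sumr mulr_suml -big_split/=; apply: eq_bigr => j _.
  rewrite -mulr_sumr big_split/= -[X in _ + X]mulr_suml sumr_const card_ord.
  rewrite -[_ ^+ 2 *+ n]mulr_natl.
  by field.
rewrite deltaE [X in _ <= X]mulrDr addrC.
have -> : m%:R * s * (S3 / (s * S2)) = n%:R / s ^+ 2 * S3.
  have n_neq0 : n%:R != 0 :> R.
    by apply/eqP => n0; move: (exprn_gt0 2 s0); rewrite sE n0 !mul0r ltxx.
  have -> : m%:R * s * (S3 / (s * S2)) = m%:R / S2 * S3.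
    by field; rewrite S2_neq0.
  by rewrite sE; field; rewrite S2_neq0 m_neq0.
rewrite lerD2r le_eqVlt; apply/orP; left; apply/eqP; field.
exact: s_neq0.
Qed.

End SteinSample.

(** * Moments of a simple random sample *)

Section Expectation.
Context {R : realType} {m n : nat} d (T : measurableType d) (P : probability T R).
Variable J : T -> n.-tuple 'I_m.
Hypothesis srsJ : simple_random_sample P J.

Lemma expectation_sample (F : n.-tuple 'I_m -> R) :
  ('E_P[F \o J] = (avg F)%:E)%E.
Proof.
have mJ t : measurable (J @^-1` [set t]) by case: (srsJ t).
have -> : F \o J = (fun x => \sum_t F t * \1_(J @^-1` [set t]) x).
  apply/funext => x; rewrite (bigD1 (J x))//= big1 ?addr0.
    by rewrite indicE mem_set// mulr1.
  by move=> t tJ; rewrite indicE memNset ?mulr0//= => Jt; rewrite Jt eqxx in tJ.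
have iF t : P.-integrable setT (fun x => (F t * \1_(J @^-1` [set t]) x)%:E).
  under eq_fun do rewrite EFinM.
  by apply: integrableZl => //; exact: integrable_indic.
rewrite expectation.unlock.
under eq_integral do rewrite -sumEFin.
rewrite integral_sum//.
have EF t : (\int[P]_x (F t * \1_(J @^-1` [set t]) x)%:E =
    (if uniq t then #|[set s : n.-tuple 'I_m | uniq s]%SET|%:R^-1 * F t else 0)%:E)%E.
  under eq_integral do rewrite EFinM.
  rewrite integralZl//; last exact: integrable_indic.
  rewrite integral_indic// setIT.
  have /(congr1 (fun y => (F t)%:E * y)%E) -> := (srsJ t).2.
  by rewrite -EFinM; case: ifPn => _; rewrite ?mulr0// mulrC.
under eq_bigr do rewrite EF.
by rewrite sumEFin -big_mkcond /avg mulr_sumr.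
Qed.

Lemma variance_sample (F : n.-tuple 'I_m -> R) : (n < m)%N ->
  ('V_P[F \o J] = (avg (fun t => F t ^+ 2) - avg F ^+ 2)%:E)%E.
Proof.
move=> nm; rewrite /variance covariance.unlock expectation_sample/=.
set G := (X in expectation _ X).
have -> : G = (fun t => (F t - avg F) ^+ 2) \o J.
  by apply/funext => x; rewrite /G/= expr2.
rewrite expectation_sample; congr EFin.
transitivity (avg (fun t => F t ^+ 2 - (2 * avg F) * F t + avg F ^+ 2)).
  by apply: eq_avg => t _; ring.
rewrite avgD avgB avgZ avg_cst ?(ltnW nm)//; ring.
Qed.

End Expectation.

(** * Real functions with a given derivative *)

Section RealAnalysis.
Context {R : realType}.
Implicit Types (f df g dg : R -> R) (x y a b : R).

Lemma is_derive_continuous f df : (forall x, is_derive x 1 f (df x)) ->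
  continuous f.
Proof.
move=> fdf x; apply: differentiable_continuous; apply/derivable1_diffP.
by have [] := fdf x.
Qed.

Lemma MVT_everywhere f df a b : (forall x, is_derive x 1 f (df x)) -> a < b ->
  exists2 c, a < c < b & f b - f a = df c * (b - a).
Proof.
move=> fdf ab; have [|c cab fE] := MVT ab (fun x _ => fdf x).
  exact/continuous_subspaceT/(is_derive_continuous fdf).
by exists c => //; move: cab; rewrite in_itv.
Qed.

Lemma is_derive_lipschitz f df (k : R) : (forall x, is_derive x 1 f (df x)) ->
  (forall x, `|df x| <= k) -> forall x y, `|f x - f y| <= k * `|x - y|.
Proof.
move=> fdf dfk x y; wlog xy : x y / y < x => [H|].
  have [xy|yx|->] := ltgtP x y.
  - by rewrite distrC [`|x - y|]distrC; exact: H.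
  - exact: H.
  - by rewrite !subrr normr0 mulr0.
have [c _ ->] := MVT_everywhere fdf xy.
by rewrite normrM ler_wpM2r.
Qed.

Lemma is_derive_nincr f df a : (forall x, is_derive x 1 f (df x)) ->
  (forall x, a <= x -> df x <= 0) -> forall b, a <= b -> f b <= f a.
Proof.
move=> fdf dfk b; rewrite le_eqVlt => /predU1P[->//|ab].
have [c /andP[ac cb] E] := MVT_everywhere fdf ab.
by rewrite -subr_le0 E mulr_le0_ge0 ?dfk ?subr_ge0 // ltW.
Qed.

Lemma is_derive_taylor f df (k : R) : (forall x, is_derive x 1 f (df x)) ->
  (forall x y, `|df x - df y| <= (2 * k) * `|x - y|) ->
  forall x b, 0 <= b -> `|f (x + b) - f x - b * df x| <= k * b ^+ 2.
Proof.
move=> fdf dfk x b b0.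
have shift y : is_derive y 1 (fun b => f (x + b)) (df (x + y)).
  have d1 : is_derive y 1 (cst x + id : R -> R) 1.
    by apply: is_derive_eq; rewrite add0r.
  by have := is_derive1_comp (fdf (x + y)) d1; rewrite mulr1.
have D (s : R) y : is_derive y 1
   (fun b => s * (f (x + b) - f x - b * df x) - k * b ^+ 2)
   (s * (df (x + y) - df x) - 2 * k * y).
  pose h : R -> R := fun b => f (x + b).
  have hy : is_derive y 1 h (df (x + y)) := shift y.
  rewrite [X in is_derive _ _ X](_ : _ = s \*: (h - cst (f x) - df x \*: id) -
    k \*: (id ^+ 2)); last first.
    by apply/funext => z; rewrite /= !fctE/= /h/= /GRing.scale/=; ring.
  by apply: is_derive_eq; rewrite /GRing.scale/= /cst /=; ring.
have bound (s : R) : `|s| = 1 -> s * (f (x + b) - f x - b * df x) <= k * b ^+ 2.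
  move=> s1; rewrite -subr_le0.
  have := is_derive_nincr (D s) _ b0.
  rewrite addr0 subrr mul0r subr0 mulr0 expr0n/= mulr0 subr0; apply => y y0.
  rewrite subr_le0 (le_trans (ler_norm _))// normrM s1 mul1r.
  by rewrite (le_trans (dfk _ _))// addrAC subrr add0r ger0_norm.
rewrite ler_norml; apply/andP; split.
  by have := bound (-1); rewrite normrN1 mulN1r lerNl; apply.
by have := bound 1; rewrite normr1 mul1r; apply.
Qed.

End RealAnalysis.

(** * The standard normal density *)

Section Gauss.
Context {R : realType}.
Implicit Types (x y : R).
Local Notation mu := (@lebesgue_measure R).
Local Notation p := (@normal_pdf R 0 1).
Local Notation p0 := (@normal_peak R 1).

Lemma stdnormal_pdfE x : p x = p0 * expR (- x ^+ 2 / 2).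
Proof. by rewrite normal_pdfE// /normal_fun subr0 expr1n. Qed.

Lemma stdnormal_peakE : p0 = (Num.sqrt (2 * pi))^-1.
Proof. by rewrite /normal_peak expr1n mul1r mulr_natl. Qed.

Lemma stdnormal_peak_bounds : 3^-1 <= p0 <= 2^-1.
Proof.
rewrite stdnormal_peakE; have pi2 := @pi_ge2 R; have pi4 := @pihalf_lt2 R.
have s0 : 0 < Num.sqrt (2 * pi : R) by rewrite sqrtr_gt0; lra.
rewrite !lef_pV2 ?posrE//; apply/andP; split.
  by rewrite -[leRHS]ger0_norm// -sqrtr_sqr ler_sqrt; lra.
by rewrite -[leLHS]ger0_norm// -sqrtr_sqr ler_sqrt; lra.
Qed.

Lemma sqrt_eight_pi : Num.sqrt (8 / pi : R) = 4 * p0.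
Proof.
have pi0 := @pi_gt0 R.
apply/eqP; rewrite -(eqrXn2 (n := 2))//; last first.
  by rewrite mulr_ge0// normal_peak_ge0.
rewrite sqr_sqrtr; last by rewrite divr_ge0// ltW.
rewrite stdnormal_peakE exprMn exprVn sqr_sqrtr; last by rewrite mulr_ge0// ltW.
by apply/eqP; move: pi0; generalize (pi : R) => q q0; field; rewrite gt_eqF.
Qed.

Lemma stdnormal_pdf_gt0 x : 0 < p x.
Proof. by rewrite stdnormal_pdfE mulr_gt0 ?expR_gt0// normal_peak_gt0. Qed.

Lemma stdnormal_pdf_le_half x : p x <= 2^-1.
Proof.
have /andP[_] := stdnormal_peak_bounds; apply: le_trans.
exact/normal_pdf_ub/oner_neq0.
Qed.

Lemma stdnormal_pdfN x : p (- x) = p x.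
Proof. by rewrite !stdnormal_pdfE sqrrN. Qed.

Lemma stdnormal_pdf0 : p 0 = p0.
Proof. by rewrite stdnormal_pdfE expr0n/= oppr0 mul0r expR0 mulr1. Qed.

Lemma is_derive_stdnormal_pdf x : is_derive x 1 p (- x * p x).
Proof.
rewrite [X in is_derive _ _ X](_ : _ = p0 \*: (expR \o ((- 2^-1) \*: (id ^+ 2)))); last first.
  apply/funext => y/=; rewrite stdnormal_pdfE !fctE/= /GRing.scale/=.
  by congr (_ * expR _); field.
apply: is_derive_eq.
rewrite /GRing.scale/= !fctE/= /GRing.scale/= stdnormal_pdfE.
rewrite (_ : - 2^-1 * x ^+ 2 = - x ^+ 2 / 2); last by field.
by field.
Qed.

Lemma cvg_stdnormal_pdf : p x @[x --> +oo] --> (0 : R).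
Proof.
rewrite (_ : p = fun x => p0 * gauss_fun (x / Num.sqrt 2)); last first.
  apply/funext => x; rewrite stdnormal_pdfE /gauss_fun exprMn exprVn sqr_sqrtr//.
  by rewrite mulNr.
rewrite -[X in _ --> X](mulr0 p0); apply: cvgM; first exact: cvg_cst.
apply: (cvg_comp _ gauss_fun) cvg_gauss_fun.
apply: gt0_cvgMly; first by rewrite invr_gt0 sqrtr_gt0.
exact: cvg_id.
Qed.

(** [G] stands for a Gaussian tail.  The difference [G - b p] is nonincreasing; were
    it negative somewhere, [b p] would stay away from zero at infinity, whereas
    [b] is bounded and [p] vanishes there. *)
Lemma mills_lower (G b db : R -> R) (C : R) :
  (forall x, 0 <= G x) -> (forall x, is_derive x 1 G (- p x)) ->
  (forall x, is_derive x 1 b (db x)) ->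
  (forall x, 0 <= x -> x * b x - 1 <= db x) ->
  (forall x, 0 <= x -> b x <= C) -> 0 < C ->
  forall x, 0 <= x -> b x * p x <= G x.
Proof.
move=> G0 dG dbE dbge bC C0 x x0; rewrite leNgt; apply/negP => Gx.
have dU y : is_derive y 1 (G - b * p) (- p y - (b y * (- y * p y) + p y * db y)).
  have dp := is_derive_stdnormal_pdf y.
  by apply: is_derive_eq; rewrite /GRing.scale/=.
have Ule y : x <= y -> G y - b y * p y <= G x - b x * p x.
  move=> xy; have := is_derive_nincr dU _ xy; apply => z xz.
  have := dbge _ (le_trans x0 xz); have := stdnormal_pdf_gt0 z; nra.
have e0 : 0 < (b x * p x - G x) / C by rewrite divr_gt0// subr_gt0.
have /cvgrPdist_lt /(_ _ e0) H := cvg_stdnormal_pdf.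
near (pinfty_nbhs R) => y.
have xy : x <= y by near: y; apply: nbhs_pinfty_ge; rewrite num_real.
have : `|0 - p y| < (b x * p x - G x) / C by near: y; exact: H.
rewrite sub0r normrN ger0_norm ?(ltW (stdnormal_pdf_gt0 _))// ltr_pdivlMr//.
have := Ule _ xy; have := G0 y; have := bC _ (le_trans x0 xy).
have := stdnormal_pdf_gt0 y; nra.
Unshelve. all: by end_near. Qed.

End Gauss.

(** * Gaussian integrals over half-lines *)

Section GaussIntegrals.
Context {R : realType}.
Implicit Types (f h : R -> R) (x y t c s : R).
Local Notation mu := (@lebesgue_measure R).
Local Notation p := (@normal_pdf R 0 1).
Local Notation p0 := (@normal_peak R 1).

Definition gauss_integrable f := mu.-integrable setT (EFin \o (f \* p)).
Definition gauss_lower f x := (\int[mu]_(t in `]-oo, x]) (f t * p t))%R.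
Definition gauss_upper f x := (\int[mu]_(t in `]x, +oo[) (f t * p t))%R.
Definition gauss_mean f := (\int[mu]_t (f t * p t))%R.
Local Notation L := gauss_lower.
Local Notation U := gauss_upper.
Local Notation M := gauss_mean.

Lemma gauss_mean_split f x : gauss_integrable f -> M f = L f x + U f x.
Proof.
move=> fi; rewrite /M /L /U -Rintegral_setU//.
- by congr Rintegral; rewrite -itv_bndbnd_setU//= set_itvNyy.
- by apply: (integrableS _ _ _ fi) => //; exact: measurableU.
- apply/disj_setPLR => t /=; rewrite !in_itv/= andbT => tx.
  by apply/negP; rewrite -leNgt.
Qed.

Lemma integral_upper_abs :
  (\int[mu]_(t in `[0%R, +oo[) (`|t| * p t)%:E = p0%:E)%E.
Proof.
have D x : is_derive x 1 (fun t => - p t) (x * p x).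
  rewrite [X in is_derive _ _ X](_ : _ = - p)//.
  by have dp := is_derive_stdnormal_pdf x; apply: is_derive_eq; rewrite mulNr opprK.
rewrite (@ge0_continuous_FTC2y _ _ (fun t => - p t) 0 0).
- by rewrite stdnormal_pdf0 EFinN sub0e oppeK.
- by move=> x _; rewrite mulr_ge0// normal_pdf_ge0.
- apply: continuous_subspaceT => x; apply: cvgM; first exact: norm_continuous.
  exact/continuous_normal_pdf/oner_neq0.
- by rewrite -[X in _ --> X]oppr0; apply: cvgN; exact: cvg_stdnormal_pdf.
- by move=> x _; have [] := D x.
- apply: cvg_at_right_filter; apply: cvgN.
  exact/continuous_normal_pdf/oner_neq0.
- move=> x; rewrite in_itv/= andbT => x0; rewrite derive1E.
  by have [_ ->] := D x; rewrite gtr0_norm.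
Qed.

Lemma integral_abs : (\int[mu]_t (`|t| * p t)%:E = (2 * p0)%:E)%E.
Proof.
rewrite ge0_symfun_integralT; first last.
- by move=> x /=; rewrite normrN stdnormal_pdfN.
- move=> x; apply: cvgM; first exact: norm_continuous.
  exact/continuous_normal_pdf/oner_neq0.
- by move=> x; rewrite mulr_ge0// normal_pdf_ge0.
by rewrite -set_itvcy integral_upper_abs EFinM.
Qed.

Lemma lipschitz1_continuous h : (forall x y, `|h x - h y| <= `|x - y|) ->
  continuous h.
Proof.
move=> hl x; apply/cvgrPdist_lt => e e0; near=> y.
by rewrite (le_lt_trans (hl _ _))//; near: y; apply: cvgr_dist_lt.
Unshelve. all: by end_near. Qed.

Lemma gauss_integrable_abs : gauss_integrable (fun t => `|t|).
Proof.
apply/integrableP; split.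
  apply/measurable_EFinP; apply: measurable_funM.
    exact: (continuous_measurable_fun (@norm_continuous R R)).
  exact: measurable_normal_pdf.
under eq_integral.
  move=> t _; rewrite /= ger0_norm; last by rewrite mulr_ge0// normal_pdf_ge0.
  over.
by rewrite integral_abs ltry.
Qed.

Lemma gauss_integrable_cst c : gauss_integrable (fun=> c).
Proof.
rewrite /gauss_integrable (_ : _ \o _ = fun t => (c%:E * (p t)%:E)%E) //.
apply: integrableZl => //.
exact: integrable_normal_pdf.
Qed.

Lemma gauss_integrable_lipschitz h : (forall x y, `|h x - h y| <= `|x - y|) ->
  gauss_integrable h.
Proof.
move=> hl.
have D : gauss_integrable (fun t => `|h 0| + `|t|).
  rewrite /gauss_integrable (_ : _ \o _ = (fun t => (`|h 0| * p t)%:E + (`|t| * p t)%:E)%E).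
    by apply: integrableD => //; [exact: gauss_integrable_cst|exact: gauss_integrable_abs].
  by apply/funext => t/=; rewrite mulrDl EFinD.
apply: le_integrable D => //.
  apply/measurable_EFinP; apply: measurable_funM; last exact: measurable_normal_pdf.
  exact: (continuous_measurable_fun (lipschitz1_continuous hl)).
move=> t tT /=; rewrite lee_fin !normrM ler_wpM2r// [leRHS]ger0_norm ?addr_ge0//.
rewrite -[X in `|X| <= _](subrK (h 0)) addrC (le_trans (ler_normD _ _))// lerD2l.
by rewrite (le_trans (hl _ _))// subr0.
Qed.

Lemma is_derive_gauss_lower f x : gauss_integrable f -> continuous f ->
  is_derive x 1 (L f) (f x * p x).
Proof.
move=> fi cf.
have x1 : x < x + 1 by rewrite ltrDl.
have fx : mu.-integrable `]-oo, x + 1] (EFin \o (f \* p)).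
  by apply: (integrableS _ _ _ fi).
have cx : {for x, continuous (f \* p)}.
  by apply: cvgM; [exact: cf | exact/continuous_normal_pdf/oner_neq0].
have nx := ltNyr x.
have /= := continuous_FTC1 x1 fx; move=> /(_ nx cx)[dL LE].
by apply: (DeriveDef dL); rewrite -derive1E LE.
Qed.

(** The sum [L id + p] has zero derivative, so it is enough to evaluate it at 0,
    where the symmetry of [p] gives the value of the integral. *)
Lemma gauss_lower_id x : L id x = - p x.
Proof.
have idi : gauss_integrable id by apply: gauss_integrable_lipschitz.
have d y : is_derive y 1 (L id + p) 0.
  have d1 : is_derive y 1 (L id) (y * p y).
    by apply: is_derive_gauss_lower => // z; exact: cvg_id.
  have d2 := is_derive_stdnormal_pdf y.
  by apply: is_derive_eq; rewrite mulNr subrr.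
have := @is_derive_lipschitz _ _ _ 0 d (fun y => _) x 0.
rewrite normr0 mul0r => /(_ (fun=> lexx _)).
rewrite normr_le0 subr_eq0 !fctE => /eqP E.
have U0 : U (fun t => `|t|) 0 = p0.
  rewrite /U/= Rintegral_itv_obnd_cbnd; first by rewrite /Rintegral integral_upper_abs.
  by apply: (integrableS _ _ _ gauss_integrable_abs).
have L0 : L (fun t => `|t|) 0 = - L id 0.
  rewrite /L -mulN1r -RintegralZl//; last by apply: (integrableS _ _ _ idi).
  apply: eq_Rintegral => t; rewrite inE/= in_itv/= => t0.
  by rewrite ler0_norm//; ring.
have : M (fun t => `|t|) = 2 * p0 by rewrite /M /Rintegral integral_abs.
rewrite (gauss_mean_split 0 gauss_integrable_abs) U0 L0.
rewrite stdnormal_pdf0 in E; lra.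
Qed.

Lemma gauss_mean_cst c : M (fun=> c) = c.
Proof.
rewrite /M RintegralZl//; last exact: integrable_normal_pdf.
by rewrite /Rintegral integral_normal_pdf mulr1.
Qed.

Lemma gauss_mean_id : M id = 0.
Proof.
have idi : gauss_integrable id by apply: gauss_integrable_lipschitz.
rewrite (gauss_mean_split 0 idi) gauss_lower_id stdnormal_pdf0.
rewrite /U/= Rintegral_itv_obnd_cbnd; last by apply: (integrableS _ _ _ idi).
have -> : \int[mu]_(t in `[0, +oo[) (id t * p t) =
          \int[mu]_(t in `[0, +oo[) (`|t| * p t).
  apply: eq_Rintegral => t; rewrite inE/= in_itv/= andbT => t0.
  by rewrite ger0_norm.
by rewrite /Rintegral integral_upper_abs/= addNr.
Qed.

Lemma gauss_integrable_affine c s : gauss_integrable (fun t => c + s * t).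
Proof.
have idi : gauss_integrable id by apply: gauss_integrable_lipschitz.
rewrite /gauss_integrable (_ : _ \o _ = (fun t => (c * p t)%:E + s%:E * (t * p t)%:E)%E).
  apply: integrableD => //; first exact: gauss_integrable_cst.
  exact: integrableZl.
by apply/funext => t/=; rewrite mulrDl EFinD -EFinM mulrA.
Qed.

Local Notation Phi := (L (fun=> 1)).
Local Notation Phic := (U (fun=> 1)).

Lemma gauss_lower_affine c s x : L (fun t => c + s * t) x = c * Phi x - s * p x.
Proof.
have idi : gauss_integrable id by apply: gauss_integrable_lipschitz.
rewrite /L; under eq_Rintegral do rewrite mulrDl -mulrA.
have ip : mu.-integrable `]-oo, x] (EFin \o p).
  by apply: (integrableS _ _ _ (integrable_normal_pdf 0 1)).
have ii : mu.-integrable `]-oo, x] (EFin \o (fun t => t * p t)).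
  by apply: (integrableS _ _ _ idi).
rewrite RintegralD//.
- rewrite !RintegralZl// -[X in _ + _ * X = _]/(L id x) gauss_lower_id mulrN; congr (_ * _ - _).
  by rewrite mul1r.
- by apply: (integrableS _ _ _ (gauss_integrable_cst c)).
- rewrite (_ : _ \o _ = fun t => s%:E * (t * p t)%:E)%E//.
  exact: integrableZl.
Qed.

Lemma gauss_upper_affine c s x : U (fun t => c + s * t) x = c * Phic x + s * p x.
Proof.
have idi : gauss_integrable id by apply: gauss_integrable_lipschitz.
rewrite /U; under eq_Rintegral do rewrite mulrDl -mulrA.
have UE : U id x = p x.
  by have := gauss_mean_split x idi; rewrite gauss_mean_id gauss_lower_id; lra.
have ip : mu.-integrable `]x, +oo[ (EFin \o p).
  by apply: (integrableS _ _ _ (integrable_normal_pdf 0 1)).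
have ii : mu.-integrable `]x, +oo[ (EFin \o (fun t => t * p t)).
  by apply: (integrableS _ _ _ idi).
rewrite RintegralD//.
- rewrite !RintegralZl// -[X in _ + _ * X = _]/(U id x) UE; congr (_ * _ + _).
  by rewrite mul1r.
- by apply: (integrableS _ _ _ (gauss_integrable_cst c)).
- rewrite (_ : _ \o _ = fun t => s%:E * (t * p t)%:E)%E//.
  exact: integrableZl.
Qed.

Lemma le_gauss_lower f h x : gauss_integrable f -> gauss_integrable h ->
  (forall t, t <= x -> f t <= h t) -> L f x <= L h x.
Proof.
move=> fi hi fh; apply: le_Rintegral => //.
- by apply: (integrableS _ _ _ fi).
- by apply: (integrableS _ _ _ hi).
- by move=> t/=; rewrite in_itv/= => tx; rewrite ler_wpM2r ?normal_pdf_ge0 ?fh.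
Qed.

Lemma le_gauss_upper f h x : gauss_integrable f -> gauss_integrable h ->
  (forall t, x <= t -> f t <= h t) -> U f x <= U h x.
Proof.
move=> fi hi fh; apply: le_Rintegral => //.
- by apply: (integrableS _ _ _ fi).
- by apply: (integrableS _ _ _ hi).
- move=> t/=; rewrite in_itv/= andbT => /ltW tx.
  by rewrite ler_wpM2r ?normal_pdf_ge0 ?fh.
Qed.

End GaussIntegrals.

(** * Mills' ratio and the solution of Stein's equation *)

Section SteinSolution.
Context {R : realType}.
Implicit Types (f h : R -> R) (x y t c s : R).
Local Notation mu := (@lebesgue_measure R).
Local Notation p := (@normal_pdf R 0 1).
Local Notation L := gauss_lower.
Local Notation U := gauss_upper.
Local Notation M := gauss_mean.
Local Notation Phi := (L (fun=> 1)).
Local Notation Phic := (U (fun=> 1)).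

Lemma PhiDPhic x : Phi x + Phic x = 1.
Proof. by rewrite -gauss_mean_split ?gauss_mean_cst//; exact: gauss_integrable_cst. Qed.

Lemma Phi_ge0 x : 0 <= Phi x.
Proof. by apply: Rintegral_ge0 => t _; rewrite mul1r normal_pdf_ge0. Qed.

Lemma Phic_ge0 x : 0 <= Phic x.
Proof. by apply: Rintegral_ge0 => t _; rewrite mul1r normal_pdf_ge0. Qed.

Lemma is_derive_Phi x : is_derive x 1 Phi (p x).
Proof.
rewrite -[p x]mul1r; apply: (@is_derive_gauss_lower _ (fun=> 1)).
  exact: gauss_integrable_cst.
by move=> y; exact: cvg_cst.
Qed.

Lemma is_derive_Phic x : is_derive x 1 Phic (- p x).
Proof.
have -> : Phic = cst 1 - Phi :> (R -> R).
  by apply/funext => y; rewrite !fctE /=; have := PhiDPhic y; lra.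
by have dP := is_derive_Phi x; apply: is_derive_eq; rewrite sub0r.
Qed.

(** Like [Phic], the function [y |-> Phi (- y)] is non-negative with derivative [- p];
    the bounds on Mills' ratio thus apply to it and cover negative arguments. *)
Lemma is_derive_PhiN x : is_derive x 1 (fun y => Phi (- y)) (- p x).
Proof.
have dP := is_derive_Phi (- x).
have := @is_derive1_comp _ Phi -%R x _ _ dP (is_deriveNid _ _).
by rewrite mulrN1 stdnormal_pdfN.
Qed.

(** The case [b = N / D] of [mills_lower]: the hypothesis on derivatives is its
    differential inequality cleared of denominators. *)
Lemma mills_quotient (G N dN D dD : R -> R) : (forall x, 0 <= G x) ->
  (forall x, is_derive x 1 G (- p x)) ->
  (forall x, is_derive x 1 N (dN x)) -> (forall x, is_derive x 1 D (dD x)) ->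
  (forall x, 0 < D x) ->
  (forall x, 0 <= x ->
     x * N x * D x - D x ^+ 2 <= dN x * D x - N x * dD x) ->
  (forall x, 0 <= x -> N x <= D x) ->
  forall x, 0 <= x -> N x * p x <= D x * G x.
Proof.
move=> G0 dG NE DE D0 ineq ND x x0.
have D_neq0 y : D y != 0 by rewrite gt_eqF.
have dV y : is_derive y 1 (fun z => (D z)^-1) (- dD y / D y ^+ 2).
  by have dy := DE y; apply: is_derive_eq; rewrite /GRing.scale/=; field.
have : (N * (fun z => (D z)^-1)) x * p x <= G x.
  apply: (@mills_lower _ G (N * (fun z => (D z)^-1))
    (fun y => (dN y * D y - N y * dD y) / D y ^+ 2) 1) => // [y|y y0|y y0].
  - have d1 := NE y; have d2 := dV y.
    by apply: is_derive_eq; rewrite /GRing.scale/=; field.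
  - rewrite !fctE/= ler_pdivlMr ?exprn_gt0//.
    rewrite [leLHS](_ : _ = y * N y * D y - D y ^+ 2) ?ineq//; by field.
  - by rewrite !fctE/= ler_pdivrMr ?mul1r ?ND.
by rewrite !fctE/= mulrAC ler_pdivrMr// [G x * _]mulrC.
Qed.

Lemma mills_first_order (G : R -> R) : (forall x, 0 <= G x) ->
  (forall x, is_derive x 1 G (- p x)) ->
  forall x, x * p x <= (1 + x ^+ 2) * G x.
Proof.
move=> G0 dG x; have x2 y : 0 < 1 + y ^+ 2 by rewrite ltr_pwDl// sqr_ge0.
have [x0|/ltW x0] := leP 0 x; last first.
  have := x2 x; have := G0 x; have := stdnormal_pdf_gt0 x; nra.
pose q : R -> R := cst 1 + id * id.
have qE y : q y = 1 + y ^+ 2 by [].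
have dq y : is_derive y 1 q (2 * y).
  have dy := is_deriveD (is_derive_cst (1 : R) y 1)
    (is_deriveM (is_derive_id y 1) (is_derive_id y 1)).
  by apply: (is_derive_eq dy); rewrite add0r /GRing.scale/= mulr1 -mulr2n mulr_natl.
have q0 y : 0 < q y by rewrite qE.
have ineq y : 0 <= y -> y * id y * q y - q y ^+ 2 <= cst 1 y * q y - id y * (2 * y).
  move=> _; rewrite qE /cst/= -subr_ge0.
  by rewrite [X in 0 <= X](_ : _ = 2)//; ring.
have idq y : 0 <= y -> id y <= q y by move=> y0; rewrite qE /=; nra.
exact: (@mills_quotient G id (cst 1) q _ G0 dG (fun y => is_derive_id y 1) dq q0 ineq idq).
Qed.

Lemma mills_second_order (G : R -> R) : (forall x, 0 <= G x) ->
  (forall x, is_derive x 1 G (- p x)) ->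
  forall x, 0 <= x -> (x + 2) * p x <= (x ^+ 2 + 2 * x + 2) * G x.
Proof.
move=> G0 dG x x0.
pose q : R -> R := id * id + 2 \*: id + cst 2.
have qE y : q y = y ^+ 2 + 2 * y + 2 by [].
have NE y : (id + cst 2) y = y + 2 :> R by [].
have q0 y : 0 < q y.
  by rewrite qE (_ : _ + _ = (y + 1) ^+ 2 + 1) ?ltr_wpDl ?sqr_ge0//; ring.
have dN y : is_derive y 1 (id + cst 2 : R -> R) (cst 1 y).
  have dy := is_deriveD (is_derive_id y 1) (is_derive_cst (2 : R) y 1).
  by apply: (is_derive_eq dy); rewrite addr0.
have dq y : is_derive y 1 q (2 * y + 2).
  have dy := is_deriveD (is_deriveD
    (is_deriveM (is_derive_id y 1) (is_derive_id y 1))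
    (is_deriveZ 2 (is_derive_id y 1))) (is_derive_cst (2 : R) y 1).
  by apply: (is_derive_eq dy); rewrite addr0 /GRing.scale/= !mulr1 -mulr2n mulr_natl.
have ineq y : 0 <= y -> y * (id + cst 2) y * q y - q y ^+ 2 <=
    cst 1 y * q y - (id + cst 2) y * (2 * y + 2).
  move=> _; rewrite NE qE /cst/= -subr_ge0.
  by rewrite [X in 0 <= X](_ : _ = y ^+ 2 + 2) ?addr_ge0 ?sqr_ge0//; ring.
have Nq y : 0 <= y -> (id + cst 2) y <= q y by move=> y0; rewrite NE qE; nra.
exact: (@mills_quotient G _ _ q _ G0 dG dN dq q0 ineq Nq).
Qed.

(** On the half-line, [h - h x] lies between the two affine functions of slope
    [1] and [-1] that vanish at [x]; likewise for the right half-line below. *)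
Lemma gauss_lower_bound h x : (forall x y, `|h x - h y| <= `|x - y|) ->
  `|L h x - h x * Phi x| <= p x + x * Phi x.
Proof.
move=> hl; have hi := gauss_integrable_lipschitz hl.
have hx t : t <= x -> `|h t - h x| <= x - t.
  by move=> tx; rewrite (le_trans (hl _ _))// distrC ger0_norm// subr_ge0.
rewrite ler_norml; apply/andP; split.
  have : L (fun t => (h x - x) + 1 * t) x <= L h x.
    apply: le_gauss_lower => //; first exact: gauss_integrable_affine.
    by move=> t /hx; rewrite ler_norml => /andP[? _]; lra.
  by rewrite gauss_lower_affine; lra.
have : L h x <= L (fun t => (h x + x) + (-1) * t) x.
  apply: le_gauss_lower => //; first exact: gauss_integrable_affine.
  by move=> t /hx; rewrite ler_norml => /andP[_ ?]; lra.
by rewrite gauss_lower_affine; lra.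
Qed.

Lemma gauss_upper_bound h x : (forall x y, `|h x - h y| <= `|x - y|) ->
  `|U h x - h x * Phic x| <= p x - x * Phic x.
Proof.
move=> hl; have hi := gauss_integrable_lipschitz hl.
have hx t : x <= t -> `|h t - h x| <= t - x.
  by move=> tx; rewrite (le_trans (hl _ _))// ger0_norm// subr_ge0.
rewrite ler_norml; apply/andP; split.
  have : U (fun t => (h x + x) + (-1) * t) x <= U h x.
    apply: le_gauss_upper => //; first exact: gauss_integrable_affine.
    by move=> t /hx; rewrite ler_norml => /andP[? _]; lra.
  by rewrite gauss_upper_affine; lra.
have : U h x <= U (fun t => (h x - x) + 1 * t) x.
  apply: le_gauss_upper => //; first exact: gauss_integrable_affine.
  by move=> t /hx; rewrite ler_norml => /andP[_ ?]; lra.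
by rewrite gauss_upper_affine; lra.
Qed.

(** With [D = y^2 + 2 y + 2], the bound [D b <= 2 q] reduces the claim to
    [4 y D + 8 q <= D^2], and [D^2 = 4 y D + y^4 + 4]. *)
Lemma tail_product_aux (y q b : R) : 0 <= y -> 0 < q <= 2^-1 -> 0 <= b ->
  (y ^+ 2 + 2 * y + 2) * b <= 2 * q -> 2 * (y + b) * b <= q.
Proof.
move=> y0 /andP[q0 q2] b0; set D := y ^+ 2 + 2 * y + 2 => Db.
have D0 : 0 < D by rewrite /D; nra.
rewrite -(ler_pM2l (exprn_gt0 2 D0)).
have -> : D ^+ 2 * (2 * (y + b) * b) = 2 * (y * D + D * b) * (D * b) by ring.
have Db0 : 0 <= D * b by rewrite mulr_ge0// ltW.
apply: (@le_trans _ _ (2 * (y * D + 2 * q) * (2 * q))).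
  by apply: ler_pM => //; [rewrite mulr_ge0// addr_ge0// mulr_ge0// ltW|
    rewrite ler_wpM2l// lerD2l].
have -> : D ^+ 2 * q = (4 * (y * D) + (y ^+ 4 + 4)) * q by rewrite /D; ring.
have -> : 2 * (y * D + 2 * q) * (2 * q) = (4 * (y * D) + 8 * q) * q by ring.
rewrite ler_wpM2r ?(ltW q0)// lerD2l; have : 0 <= y ^+ 4 by rewrite exprn_ge0.
by lra.
Qed.

(** The left side is [p] times the value of [|g'|] in the worst case
    [h t = |t - x|]. Its two factors differ by [x], and the smaller one is
    controlled by [mills_second_order]. *)
Lemma tail_product x : 2 * (p x + x * Phi x) * (p x - x * Phic x) <= p x.
Proof.
have p0 := stdnormal_pdf_gt0 x; have p2 := stdnormal_pdf_le_half x.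
have PhiE : Phi x = 1 - Phic x by have := PhiDPhic x; lra.
have A0 : 0 <= p x + x * Phi x.
  by apply: le_trans (gauss_lower_bound x (h := id) _).
have B0 : 0 <= p x - x * Phic x.
  by apply: le_trans (gauss_upper_bound x (h := id) _).
have [x0|/ltW x0] := leP 0 x.
  have := mills_second_order Phic_ge0 is_derive_Phic x0 => m.
  have -> : p x + x * Phi x = x + (p x - x * Phic x).
    by rewrite PhiE; ring.
  apply: tail_product_aux => //; first by rewrite p0.
  by nra.
have y0 : 0 <= - x by rewrite oppr_ge0.
have PN y : 0 <= Phi (- y) := Phi_ge0 _.
have := mills_second_order PN is_derive_PhiN y0; rewrite opprK stdnormal_pdfN => m.
rewrite -mulrA [X in 2 * X]mulrC mulrA.
have -> : p x - x * Phic x = - x + (p x + x * Phi x).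
  by rewrite PhiE; ring.
apply: tail_product_aux => //; first by rewrite p0.
by nra.
Qed.

(** By Stein's equation, [g'] is the sum of [y |-> y * g y], shown to be
    1-Lipschitz through its derivative, and of the 1-Lipschitz [h - M h]. *)
Lemma stein_solution h : (forall x y, `|h x - h y| <= `|x - y|) ->
  exists g dg : R -> R,
  [/\ forall x, dg x - x * g x = h x - M h,
      forall x y, `|g x - g y| <= `|x - y| &
      forall x b, 0 <= b -> `|g (x + b) - g x - b * dg x| <= b ^+ 2].
Proof.
move=> hl; have hi := gauss_integrable_lipschitz hl.
pose g x := (L h x - M h * Phi x) / p x.
pose dg x := x * g x + (h x - M h).
have p_neq0 x : p x != 0 by rewrite gt_eqF// stdnormal_pdf_gt0.
have dgE x : is_derive x 1 g (dg x).
  have d1 := is_derive_gauss_lower x hi (lipschitz1_continuous hl).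
  have d2 := is_derive_Phi x; have d3 := is_derive_stdnormal_pdf x.
  have d4 : is_derive x 1 (fun z => (p z)^-1) (x / p x).
    by apply: is_derive_eq; rewrite /GRing.scale/=; field.
  rewrite [X in is_derive _ _ X](_ : _ = (L h - M h \*: Phi) * (fun z => (p z)^-1))//.
  have quotient_rule (a b c y : R) (q := p x) :
      (a - b * c) * (x / q) + q^-1 * (y * q - b * q) =
      x * ((a - b * c) / q) + (y - b) by rewrite /q; field.
  by apply: is_derive_eq; exact: quotient_rule.
pose l x := L h x - h x * Phi x; pose u x := U h x - h x * Phic x.
have PhicE x : Phic x = 1 - Phi x by have := PhiDPhic x; lra.
have ME x : M h = l x + u x + h x.
  by rewrite (gauss_mean_split x hi) /l /u PhicE; ring.
have gE x : p x * g x = l x * Phic x - u x * Phi x.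
  by rewrite /g mulrC divfK// (ME x) /l /u PhicE; ring.
have lA x := gauss_lower_bound x hl; have uB x := gauss_upper_bound x hl.
have norm_p x (r : R) : `|p x * r| <= p x -> `|r| <= 1.
  by rewrite normrM ger0_norm ?normal_pdf_ge0// -{2}[p x]mulr1 ler_pM2l// stdnormal_pdf_gt0.
have dg1 x : `|dg x| <= 1.
  apply: (@norm_p x).
  have -> : p x * dg x = - (l x * (p x - x * Phic x)) - u x * (p x + x * Phi x).
    by rewrite /dg mulrDr mulrCA gE (ME x); ring.
  have A0 := le_trans (normr_ge0 _) (lA x); have B0 := le_trans (normr_ge0 _) (uB x).
  rewrite (le_trans (ler_normB _ _))// normrN !normrM (ger0_norm A0) (ger0_norm B0).
  apply: le_trans (tail_product x).
  have := ler_wpM2r B0 (lA x); have := ler_wpM2r A0 (uB x); rewrite /l /u; lra.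
have dpsiE x : is_derive x 1 (fun y => y * g y) (g x + x * dg x).
  have dgx := dgE x; rewrite [X in is_derive _ _ X](_ : _ = id * g)//.
  by apply: is_derive_eq; rewrite /GRing.scale/=; ring.
have dpsi1 x : `|g x + x * dg x| <= 1.
  apply: (@norm_p x).
  have -> : p x * (g x + x * dg x) =
      l x * ((1 + x ^+ 2) * Phic x - x * p x)
      - u x * ((1 + x ^+ 2) * Phi x + x * p x).
    have -> : p x * (g x + x * dg x) = (1 + x ^+ 2) * (p x * g x) + x * p x * (h x - M h).
      by rewrite /dg; ring.
    by rewrite gE (ME x); ring.
  have m1 : 0 <= (1 + x ^+ 2) * Phic x - x * p x.
    by rewrite subr_ge0; exact: (mills_first_order Phic_ge0 is_derive_Phic).
  have m2 : 0 <= (1 + x ^+ 2) * Phi x + x * p x.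
    have PN y : 0 <= Phi (- y) := Phi_ge0 _.
    have := mills_first_order PN is_derive_PhiN (- x).
    by rewrite opprK stdnormal_pdfN sqrrN; lra.
  rewrite (le_trans (ler_normB _ _))// !normrM (ger0_norm m1) (ger0_norm m2).
  (* The bound [p x] is attained by [h t = t], for which [g] is constant. *)
  have pE : (p x + x * Phi x) * ((1 + x ^+ 2) * Phic x - x * p x) +
    (p x - x * Phic x) * ((1 + x ^+ 2) * Phi x + x * p x) = p x.
    by rewrite PhicE; ring.
  rewrite -[leRHS]pE; apply: lerD.
    exact: (ler_wpM2r m1 (lA x)).
  exact: (ler_wpM2r m2 (uB x)).
exists g, dg; split.
- by move=> x; rewrite /dg; ring.
- by move=> x y; rewrite -[leRHS]mul1r; exact: is_derive_lipschitz dgE dg1 x y.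
- move=> x b b0; rewrite -[leRHS]mul1r; apply: is_derive_taylor => // {b0 x b} x y.
  have -> : dg x - dg y = (x * g x - y * g y) + (h x - h y) by rewrite /dg; ring.
  rewrite (le_trans (ler_normD _ _))// (_ : 2 * 1 * _ = 1 * `|x - y| + `|x - y|); last by ring.
  by apply: lerD => //; exact: is_derive_lipschitz dpsiE dpsi1 x y.
Qed.

End SteinSolution.

(** * Expectations under the standard normal law *)

Section StandardNormal.
Context {R : realType}.
Implicit Types (f h : R -> R).
Local Notation mu := (@lebesgue_measure R).
Local Notation p := (@normal_pdf R 0 1).

(** The normal law is given as a set function with a density; uniqueness of the
    Radon-Nikodym derivative transfers the density to integrals of functions. *)
Lemma ge0_integral_normal_prob (f : R -> \bar R) :
  measurable_fun [set: R] f -> (forall x, 0 <= f x)%E ->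
  (\int[normal_prob 0 1]_x f x = \int[mu]_x (f x * (p x)%:E))%E.
Proof.
move=> mf f0.
have dom := @normal_prob_dominates R 0 1.
rewrite -(Radon_Nikodym_SigmaFinite.change_of_variables dom)//.
have mRN : measurable_fun setT (Radon_Nikodym_SigmaFinite.f (normal_prob 0 1) mu).
  exact: (measurable_int _ (Radon_Nikodym_SigmaFinite.f_integrable dom)).
have mp : measurable_fun [set: R] (fun x => (p x)%:E).
  by apply/measurable_EFinP; exact: measurable_normal_pdf.
apply: ae_eq_integral => //.
- exact: emeasurable_funM.
- exact: emeasurable_funM.
- apply: ae_eqe_mul2l => /=; apply: integral_ae_eq => //.
  + exact: Radon_Nikodym_SigmaFinite.f_integrable.
  + by move=> E _ mE; rewrite -Radon_Nikodym_SigmaFinite.f_integral.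
Qed.

Lemma ge0_integral_standard_normal d (T : measurableType d) (P : probability T R)
    (Z : {RV P >-> R}) (f : R -> \bar R) : standard_normal Z ->
  measurable_fun [set: R] f -> (forall x, 0 <= f x)%E ->
  (\int[P]_w f (Z w) = \int[mu]_x (f x * (p x)%:E))%E.
Proof.
move=> ZN mf f0; rewrite -ge0_integral_normal_prob//.
(* The law of [Z] is built on the default measurable structure of [R], and
   [normal_prob] on the one carrying the Lebesgue measure.  They have the same
   measurable sets, so [Z] is also a random variable for the latter. *)
have mZ : measurable_fun [set: T] (Z : T -> measurableTypeR R).
  by have mZ := @measurable_funPT _ _ _ _ Z; move=> mT A mA; exact: mZ.
transitivity (\int[P]_(w in Z @^-1` setT) (f \o Z) w)%E; first by rewrite preimage_setT.
rewrite -(ge0_integral_pushforward mZ)//.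
by apply: eq_measure_integral => A mA _; exact: ZN.
Qed.

Lemma expectation_standard_normal d (T : measurableType d) (P : probability T R)
    (Z : {RV P >-> R}) h : standard_normal Z ->
  (forall x y, `|h x - h y| <= `|x - y|) ->
  ('E_P[h \o Z] = (gauss_mean h)%:E)%E.
Proof.
move=> ZN hl; have hi := gauss_integrable_lipschitz hl.
have mh : measurable_fun [set: R] (EFin \o h).
  apply/measurable_EFinP.
  exact: (continuous_measurable_fun (lipschitz1_continuous hl)).
rewrite expectation.unlock /gauss_mean /Rintegral fineK; last exact: integrable_fin_num.
rewrite [LHS]integralE [RHS]integralE.
transitivity (\int[P]_w (EFin \o h)^\+ (Z w) - \int[P]_w (EFin \o h)^\- (Z w))%E.
  by congr (_ - _)%E; apply: eq_integral => w _; rewrite ?funeposE ?funenegE.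
rewrite (ge0_integral_standard_normal ZN (measurable_funepos mh)) ?funepos_ge0//.
rewrite (ge0_integral_standard_normal ZN (measurable_funeneg mh)) ?funeneg_ge0//.
congr (_ - _)%E; apply: eq_integral => x _.
  rewrite funeposE [RHS]funeposE /= -!EFin_max -EFinM; congr EFin.
  by rewrite maxr_pMl ?normal_pdf_ge0// mul0r.
rewrite funenegE [RHS]funenegE /= -!EFin_max -EFinM; congr EFin.
by rewrite maxr_pMl ?normal_pdf_ge0// mul0r mulNr.
Qed.

(** With [Z] standard normal, the coupling of [r Z] with [Z] gives the bound
    [(r - 1) E|Z|].  The function [h (r x) / r] is the 1-Lipschitz test function to
    which Stein's equation is applied below. *)
Lemma gauss_mean_dilation h (r : R) : (forall x y, `|h x - h y| <= `|x - y|) ->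
  1 <= r ->
  `|r * gauss_mean (fun x => r^-1 * h (r * x)) - gauss_mean h|
    <= (r - 1) * (2 * normal_peak 1).
Proof.
move=> hl r1; have r0 : 0 < r by rewrite (lt_le_trans ltr01).
have hrl x y : `|r^-1 * h (r * x) - r^-1 * h (r * y)| <= `|x - y|.
  rewrite -mulrBr normrM gtr0_norm ?invr_gt0// ler_pdivrMl//.
  by rewrite (le_trans (hl _ _))// -mulrBr normrM gtr0_norm.
have hi := gauss_integrable_lipschitz hl.
have hri := gauss_integrable_lipschitz hrl.
have di : mu.-integrable setT (EFin \o (fun x => r * (r^-1 * h (r * x) * p x))).
  rewrite (_ : _ \o _ = fun x => r%:E * (r^-1 * h (r * x) * p x)%:E)%E//.
  exact: integrableZl.
have ai : mu.-integrable setT (EFin \o (fun x => (r - 1) * (`|x| * p x))).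
  rewrite (_ : _ \o _ = fun x => (r - 1)%:E * (`|x| * p x)%:E)%E//.
  by apply: integrableZl => //; exact: gauss_integrable_abs.
have -> : 2 * normal_peak 1 = gauss_mean (fun x => `|x|) :> R.
  by rewrite /gauss_mean /Rintegral integral_abs.
rewrite /gauss_mean -!RintegralZl//; last exact: gauss_integrable_abs.
have bi : mu.-integrable setT
    (EFin \o (fun x => r * (r^-1 * h (r * x) * p x) - h x * p x)).
  rewrite (_ : _ \o _ = fun x => (r * (r^-1 * h (r * x) * p x))%:E - (h x * p x)%:E)%E//.
  exact: integrableB.
rewrite -RintegralB//.
apply: (le_trans (le_normr_Rintegral _ bi)) => //.
apply: le_Rintegral => //.
  by have := integrable_norm bi.
move=> x _.
have -> : r * (r^-1 * h (r * x) * p x) - h x * p x = (h (r * x) - h x) * p x.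
  by field; rewrite gt_eqF.
rewrite normrM (ger0_norm (normal_pdf_ge0 _ _ _)) mulrA ler_wpM2r ?normal_pdf_ge0//.
rewrite (le_trans (hl _ _))// -[X in _ - X]mul1r -mulrBl normrM ger0_norm//.
by rewrite subr_ge0.
Qed.

End StandardNormal.

(** * Comparison of the two normalisations *)

Section Assembly.
Context {R : realType}.

(** Since [r (1 - 1 / r^2) = (r^2 - 1) / r <= r^2 - 1] and [2 (r - 1) <= r^2 - 1], the
    two terms are at most [3 q (r^2 - 1)] and [q (r^2 - 1)]. *)
Lemma dilation_tradeoff (r q : R) : 1 <= r -> 3^-1 <= q ->
  r * (1 - r ^- 2) + (r - 1) * (2 * q) <= 4 * q * (r ^+ 2 - 1).
Proof.
move=> r1 q3; have r0 : 0 < r by rewrite (lt_le_trans ltr01).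
have -> : r * (1 - r ^- 2) = (r ^+ 2 - 1) / r by field; rewrite gt_eqF.
have A : (r ^+ 2 - 1) / r <= r ^+ 2 - 1.
  by rewrite ler_pdivrMr// ler_peMr// subr_ge0 exprn_ege1.
apply: (@le_trans _ _ ((3 * q) * (r ^+ 2 - 1) + (r - 1) * (2 * q))).
  rewrite lerD2r; apply: (le_trans A).
  by rewrite ler_peMl ?subr_ge0 ?exprn_ege1//; lra.
rewrite -subr_ge0 [X in 0 <= X](_ : _ = q * (r - 1) ^+ 2); last by ring.
by rewrite mulr_ge0 ?sqr_ge0// (le_trans _ q3).
Qed.

(** The Stein bound is applied to [h (r x) / r] at the scale [sqrt lam], where
    [r = sqrt lam / sqrt V], and multiplied by [r]. *)
Lemma sample_lipschitz_bound (m n : nat) (a : 'I_m -> R) (h : R -> R)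
    (w := @sample_sum R m n a) (theta := avg w)
    (V := avg (fun t => w t ^+ 2) - theta ^+ 2)
    (lam := n%:R / m%:R * \sum_j a j ^+ 2) :
  (n < m)%N -> (forall j, 0 <= a j) -> 0 < V ->
  (forall x y, `|h x - h y| <= `|x - y|) ->
  `|avg (fun t => h ((Num.sqrt V)^-1 * (w t - theta))) - gauss_mean h| <=
  (\sum_j a j ^+ 3) / (Num.sqrt V * \sum_j a j ^+ 2)
  + 4 * normal_peak 1 * ((lam - V) / V).
Proof.
move=> nm a0 V0 hl; set sigma := Num.sqrt V.
have sig0 : 0 < sigma by rewrite sqrtr_gt0.
have sigE : sigma ^+ 2 = V by rewrite sqr_sqrtr// ltW.
have m0 : 0 < m%:R :> R by rewrite ltr0n (leq_ltn_trans _ nm).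
have Vlam : V <= lam.
  rewrite -subr_ge0 -(pmulr_rge0 _ m0) -(total_displacement a nm).
  apply: sumr_ge0 => j _; apply: mulr_ge0 => //; apply: sumr_ge0 => k _.
  rewrite -[leLHS](avg_cst (m := m) (n := n) (ltnW nm)).
  by apply: le_avg => t _; exact: displaced_ge0.
have lam0 : 0 < lam by rewrite (lt_le_trans V0).
pose s := Num.sqrt lam; have s0 : 0 < s by rewrite sqrtr_gt0.
have sE : s ^+ 2 = lam by rewrite sqr_sqrtr// ltW.
pose r := s / sigma.
have r1 : 1 <= r by rewrite /r ler_pdivlMr// mul1r ler_sqrt// ltW.
have r0 : 0 < r by rewrite (lt_le_trans ltr01).
pose H x := r^-1 * h (r * x).
have Hl x y : `|H x - H y| <= `|x - y|.
  rewrite /H -mulrBr normrM gtr0_norm ?invr_gt0// ler_pdivrMl//.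
  by rewrite (le_trans (hl _ _))// -mulrBr normrM gtr0_norm.
have [g [dg [steinE glip gtaylor]]] := stein_solution Hl.
have bound := stein_sample_bound nm a0 s0 sE glip gtaylor.
rewrite -/w -/theta -/V sE in bound.
have avgE : avg (fun t => h (sigma^-1 * (w t - theta))) - r * gauss_mean H =
    r * avg (fun t => dg ((w t - theta) / s) - (w t - theta) / s * g ((w t - theta) / s)).
  rewrite -{1}(avg_cst (m := m) (n := n) (ltnW nm) (r * gauss_mean H)) -avgB -avgZ.
  apply: eq_avg => t _; rewrite steinE [RHS]mulrBr; congr (_ - _).
  rewrite /H mulrA divff ?gt_eqF// mul1r; congr h.
  by rewrite /r; field; rewrite !gt_eqF.
have -> : avg (fun t => h (sigma^-1 * (w t - theta))) - gauss_mean h =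
   (avg (fun t => h (sigma^-1 * (w t - theta))) - r * gauss_mean H) +
   (r * gauss_mean H - gauss_mean h) by ring.
rewrite (le_trans (ler_normD _ _))//.
apply: (le_trans (lerD (lexx _) (gauss_mean_dilation hl r1))).
rewrite avgE normrM gtr0_norm//.
apply: (le_trans (lerD (ler_wpM2l (ltW r0) bound) (lexx _))).
have S2_neq0 : \sum_j a j ^+ 2 != 0.
  by apply/eqP => S20; move: lam0; rewrite /lam S20 mulr0 ltxx.
rewrite mulrDr.
have -> : r * ((\sum_j a j ^+ 3) / (s * \sum_j a j ^+ 2)) =
    (\sum_j a j ^+ 3) / (sigma * \sum_j a j ^+ 2).
  by rewrite /r; field; rewrite S2_neq0 !gt_eqF.
have -> : (lam - V) / lam = 1 - r ^- 2.
  by rewrite -sE -sigE /r; field; rewrite !gt_eqF.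
have -> : (lam - V) / V = r ^+ 2 - 1.
  by rewrite -sE -sigE /r; field; rewrite !gt_eqF.
have /andP[q3 _] := @stdnormal_peak_bounds R.
have := dilation_tradeoff r1 q3; lra.
Qed.

End Assembly.

Theorem proposition8 (R : realType) (m n : nat) (c : 'I_m -> nat)
    (d : measure_display) (T : measurableType d) (P : probability T R)
    (J : T -> n.-tuple 'I_m)
    (d' : measure_display) (T' : measurableType d') (P' : probability T' R)
    (Z : {RV P' >-> R}) :
  (1 <= n)%N -> (n < m)%N ->
  simple_random_sample P J ->
  standard_normal Z ->
  let Y (k : 'I_n) (w : T) : R := (c (tnth (J w) k))%:R in
  let W (w : T) : R := \sum_(k < n) Y k w in
  let S1 : R := \sum_(j < m) (c j)%:R in
  let S2 : R := \sum_(j < m) (c j)%:R ^+ 2 in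
  let S3 : R := \sum_(j < m) (c j)%:R ^+ 3 in
  let S11 : R := \sum_(i < m) \sum_(j < m | j != i) (c i)%:R * (c j)%:R in
  let theta : R := n%:R / m%:R * S1 in
  let sigma2 : R :=
    n%:R / m%:R * S2
    + (n%:R * (n%:R - 1)) / (m%:R * (m%:R - 1)) * S11
    - n%:R ^+ 2 / m%:R ^+ 2 * S1 ^+ 2 in
  let sigma : R := Num.sqrt sigma2 in
  let Wtilde (w : T) : R := sigma^-1 * (W w - theta) in
  0 < sigma2 ->
  [/\ ('E_P[W] = theta%:E)%E,
      ('V_P[W] = sigma2%:E)%E
    & (wasserstein P P' Wtilde Z <=
       (S3 / (sigma * S2)
        + Num.sqrt (8 / pi) * (n%:R / m%:R) * sigma2^-1
          * (n%:R / m%:R * S1 ^+ 2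
             - (n%:R - 1) / (m%:R - 1) * S11))%R%:E)%E].
Proof.
move=> n1 nm srs ZN Y W S1 S2 S3 S11 theta sigma2 sigma Wtilde sigma2_gt0.
pose a (j : 'I_m) : R := (c j)%:R.
have WE : W = sample_sum a \o J by [].
have m0 : 0 < m%:R :> R by rewrite ltr0n (leq_ltn_trans _ nm).
have m1 : m%:R - 1 != 0 :> R.
  by rewrite subr_eq0 pnatr_eq1 gtn_eqF// (leq_ltn_trans _ nm).
have thetaE : avg (@sample_sum _ _ n a) = theta by rewrite avg_sample_sum.
have VE : avg (fun t : n.-tuple _ => sample_sum a t ^+ 2) - avg (@sample_sum _ _ n a) ^+ 2 = sigma2.
  by rewrite avg_sample_sum_square// avg_sample_sum// exprMn expr_div_n.
split.
- by rewrite WE (expectation_sample srs) thetaE.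
- by rewrite WE (variance_sample srs)// VE.
rewrite /wasserstein; apply: ge_ereal_sup => _ [h hl <-].
rewrite (expectation_standard_normal ZN hl).
rewrite [h \o Wtilde](_ : _ = (fun t => h (sigma^-1 * (sample_sum a t - theta))) \o J)//.
rewrite (expectation_sample srs) -EFinB/= lee_fin.
have a0 j : 0 <= a j by rewrite /a.
have := @sample_lipschitz_bound R m n a h nm a0.
rewrite VE thetaE => /(_ sigma2_gt0 hl) H; apply: (le_trans H).
rewrite sqrt_eight_pi lerD2l le_eqVlt; apply/orP; left; apply/eqP.
have -> : n%:R / m%:R * (\sum_j a j ^+ 2) - sigma2 =
    n%:R / m%:R * (n%:R / m%:R * S1 ^+ 2 - (n%:R - 1) / (m%:R - 1) * S11).
  by rewrite /sigma2 -/S2; field; rewrite m1 gt_eqF.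
have regroup (x y z k : R) : x * (y * k * z) = x * y * z * k by ring.
exact: regroup.
Qed.
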